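(* Let $V_1,V_2:\mathbb{T}^d\to\mathbb{R}$ be smooth functions with finite $C^3$-norm. Then the set of Laplace equations with nonlinearity $$-\Delta(q_1+iq_2)=\frac{dV_1}{dq_1}(q_1)+i\,\frac{dV_2}{dq_2}(q_2)$$ for maps $q=(q_1,q_2):\mathbb{T}^2\to\mathbb{T}^{2d}=\mathbb{T}^d\times\mathbb{T}^d$ has at least $2d+1$ solutions.
   Context: $\mathbb{T}^n$ denotes the $n$-dimensional torus and $d\ge1$. $\Delta=\partial_{t_1}^2+\partial_{t_2}^2$ is the Laplacian on $\mathbb{T}^2$ with coordinates $(t_1,t_2)$, and $\frac{dV_j}{dq_j}$ denotes the gradient of $V_j$. Taking real and imaginary parts, the equation is the pair $-\Delta q_1=\frac{dV_1}{dq_1}(q_1)$, $-\Delta q_2=\frac{dV_2}{dq_2}(q_2)$. *)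

(* Defs.v *)
From mathcomp Require Import all_boot all_order all_algebra.
From mathcomp Require Import all_classical all_reals all_analysis.

Set Implicit Arguments.
Unset Strict Implicit.
Unset Printing Implicit Defensive.

Import Order.TTheory GRing.Theory Num.Theory.
Import numFieldNormedType.Exports.

Local Open Scope classical_set_scope.
Local Open Scope ring_scope.
Local Open Scope quotient_scope.

(* T^n is R^n / Z^n: every circle factor has length 1. *)
Definition lattice_eqb (R : realType) (n : nat) (x y : 'rV[R]_n) : bool :=
  [forall i, x 0 i - y 0 i \is a Num.int].

Lemma lattice_eqb_refl (R : realType) (n : nat) :
  reflexive (@lattice_eqb R n).
Proof. by move=> x; apply/forallP => i; rewrite subrr rpred0. Qed.

Lemma lattice_eqb_sym (R : realType) (n : nat) :
  symmetric (@lattice_eqb R n).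
Proof.
by move=> x y; apply: eq_forallb => i; rewrite -rpredN opprB.
Qed.

Lemma lattice_eqb_trans (R : realType) (n : nat) :
  transitive (@lattice_eqb R n).
Proof.
move=> y x z /forallP xy /forallP yz; apply/forallP => i.
by rewrite -(subrKA (y 0 i)) rpredD.
Qed.

Canonical lattice_equiv (R : realType) (n : nat) : equiv_rel 'rV[R]_n :=
  EquivRel (@lattice_eqb R n) (@lattice_eqb_refl R n) (@lattice_eqb_sym R n)
    (@lattice_eqb_trans R n).

Definition torus (R : realType) (n : nat) : Type :=
  {eq_quot (lattice_equiv R n)}.

Definition to_torus (R : realType) (n : nat) (x : 'rV[R]_n) : torus R n :=
  \pi_({eq_quot (lattice_equiv R n)}) x.

Definition partial (R : realType) (n : nat) (i : 'I_n) (f : 'rV[R]_n -> R) :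
    'rV[R]_n -> R :=
  fun x => 'D_(delta_mx 0 i) f x.

Definition iter_partial (R : realType) (n : nat) (s : seq 'I_n)
    (f : 'rV[R]_n -> R) : 'rV[R]_n -> R :=
  foldr (@partial R n) f s.

(* The derivability clause matters: 'D_v f x is a total function with a
   meaningless value where the directional derivative does not exist. *)
Definition smooth (R : realType) (n : nat) (f : 'rV[R]_n -> R) : Prop :=
  forall s : seq 'I_n,
    continuous (iter_partial s f) /\
    forall (x : 'rV[R]_n) (i : 'I_n),
      derivable (iter_partial s f) x (delta_mx 0 i).

Definition finite_Ck_norm (R : realType) (n k : nat) (f : 'rV[R]_n -> R) :
    Prop :=
  exists M : R, forall (s : seq 'I_n) (x : 'rV[R]_n),
    (size s <= k)%N -> `|iter_partial s f x| <= M.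

Definition gradient (R : realType) (n : nat) (f : 'rV[R]_n -> R)
    (x : 'rV[R]_n) : 'rV[R]_n :=
  \row_j partial j f x.

Definition laplacian (R : realType) (m n : nat) (Q : 'rV[R]_m -> 'rV[R]_n)
    (t : 'rV[R]_m) : 'rV[R]_n :=
  \row_j \sum_(i < m) partial i (partial i (fun u => Q u 0 j)) t.

Definition smooth_on_torus (R : realType) (n : nat) (V : torus R n -> R) :
    Prop :=
  smooth (V \o @to_torus R n).

Definition finite_Ck_norm_on_torus (R : realType) (n k : nat)
    (V : torus R n -> R) : Prop :=
  finite_Ck_norm k (V \o @to_torus R n).

(* Q is a smooth map of the universal covers R^m -> R^n lying over q.  Since
   R^m is simply connected, q : T^m -> T^n is smooth iff it has such a Q.  Q is
   not required to be periodic, so q may lie in any homotopy class. *)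
Definition smooth_lift (R : realType) (m n : nat) (q : torus R m -> torus R n)
    (Q : 'rV[R]_m -> 'rV[R]_n) : Prop :=
  (forall t, q (to_torus t) = to_torus (Q t)) /\
  forall j : 'I_n, smooth (fun t => Q t 0 j).

(* Two lifts of q differ by a constant vector of Z^n and V \o to_torus is
   Z^n-periodic, so the equation does not depend on the choice of Q. *)
Definition laplace_solution (R : realType) (d : nat) (V : torus R d -> R)
    (q : torus R 2 -> torus R d) : Prop :=
  exists2 Q : 'rV[R]_2 -> 'rV[R]_d, smooth_lift q Q &
    forall t, - laplacian Q t = gradient (V \o @to_torus R d) (Q t).

(* Real and imaginary parts of
   - Delta (q1 + i q2) = dV1/dq1 (q1) + i dV2/dq2 (q2). *)
Definition laplace_solutions (R : realType) (d : nat)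
    (V1 V2 : torus R d -> R) : set (torus R 2 -> torus R d * torus R d) :=
  [set q | laplace_solution V1 (fst \o q) /\ laplace_solution V2 (snd \o q)].

(* Main.v *)
Require Import Defs.
From mathcomp Require Import all_boot all_order all_algebra.
From mathcomp Require Import all_classical all_reals all_analysis.
From mathcomp Require Import lra.

(** The two equations are independent and autonomous, and the maps may lie in
    any homotopy class.  So a single solution of the first equation that winds
    around the torus produces infinitely many: its translates
    [t |-> q (t + s)] solve the same equation, and they are pairwise distinct
    for suitable [s] because a winding map is not constant.  Pairing these
    with one solution of the second equation gives more than enough solutions.

    Winding solutions that depend on [t_1] only are enough.  Writing
    [Q (t_1, t_2) = X (k t_1)], the equation becomes the Newton equation
    [X'' = - e grad V (X)] with [e = k^-2], and the winding condition is
    [X (t + 1) = X t + (1, ..., 1)].  Since [k] is free, the force can be made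
    as weak as desired, which puts the problem within reach of the contraction
    principle ([exists_rotating_curve]).

    For a weak force one proceeds by Lyapunov-Schmidt reduction.
    Write [X t = a + t (1, ..., 1) + u t] with [u] periodic of mean zero.  For
    each mean position [a], Picard iteration yields a unique [u] solving the
    equation up to a constant vector: [u'' = lambda - e grad V (X)]
    ([exists_orbit], [orbit_lipschitz]).  Let [Phi a] be the action of this
    curve over one period.  The Euler-Lagrange equation gives
    [Phi b - Phi a = - lambda_a . (b - a) + O (|b - a|^2)]
    ([action_expansion]), so [lambda] vanishes wherever [Phi] is minimal; and
    [Phi] has a minimum because it is continuous and invariant under integer
    translations ([exists_closed_orbit]).

    All estimates are in the sup norm.  The only inequality on periodic
    functions is that a derivative of a periodic function vanishes somewhere,
    hence is bounded by the sup of its own derivative ([periodic1_bound]).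
    Integrals enter only as differences of antiderivatives.  In several
    variables, everything (Lipschitz and Taylor bounds, the chain rule along a
    curve) comes from one mean value formula along coordinate segments
    ([partial_MVT]). *)

Set Implicit Arguments.
Unset Strict Implicit.
Unset Printing Implicit Defensive.

Import Order.TTheory GRing.Theory Num.Theory.
Import numFieldNormedType.Exports.

(** * Antiderivatives on the real line *)
Section OneVariable.
Local Open Scope classical_set_scope.
Local Open Scope ring_scope.
Variable R : realType.
Implicit Types (f g F P : R -> R).

Definition antiderivative F f := forall t, is_derive t (1 : R) F (f t).

Lemma antiderivative_continuous F f : antiderivative F f -> continuous F.
Proof.
by move=> dF t; apply/differentiable_continuous/derivable1_diffP; case: (dF t).
Qed.

Lemma antiderivative_MVT F f a b : antiderivative F f -> a < b ->
  exists2 c, c \in `]a, b[ & F b - F a = f c * (b - a).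
Proof.
move=> dF ab; apply: MVT => //.
by apply: continuous_subspaceT => x; exact: antiderivative_continuous dF x.
Qed.

Lemma antiderivative_bound F f K a b : antiderivative F f -> a <= b ->
  (forall t, a <= t <= b -> `|f t| <= K) -> `|F b - F a| <= K * (b - a).
Proof.
move=> dF; rewrite le_eqVlt => /orP[/eqP <-|ab fK].
  by rewrite !subrr normr0 mulr0.
have [c /[!in_itv]/= /andP[ac cb] ->] := antiderivative_MVT dF ab.
have ba0 : 0 <= b - a by rewrite subr_ge0 ltW.
by rewrite normrM (ger0_norm ba0) ler_wpM2r// fK// !ltW.
Qed.

(** The indefinite integral from a base point [a] has derivative [f] only to
    the right of [a].  Normalised to vanish at 0, the integrals from two
    negative base points agree where both are defined, so letting the base
    point move to the left with the argument gives one function on the line. *)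
Lemma exists_antiderivative f : continuous f -> exists F, antiderivative F f.
Proof.
move=> cf; pose mu := @lebesgue_measure R.
have intf a b : mu.-integrable `[a, b] (EFin \o f).
  apply: continuous_compact_integrable; first exact: segment_compact.
  by apply: continuous_subspaceT => x; exact: cf.
pose I a x : R := \int[mu]_(t in `[a, x]) f t.
have dI (a x : R) : a < x -> is_derive x (1 : R) (I a) (f x).
  move=> ax; have xu : x < x + 1 by rewrite ltrDl.
  have [dI <-] := continuous_FTC1_closed xu (intf a _) ax (cf x).
  by rewrite derive1E; exact/derivableP.
pose G a x := I a x - I a 0.
have dG (a x : R) : a < x -> is_derive x (1 : R) (G a) (f x).
  move=> ax; rewrite -[f x]subr0; apply: is_deriveB; exact: dI.
have GG (a b x : R) : a < 0 -> b < 0 -> a < x -> b < x -> G a x = G b x.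
  move=> a0 b0 ax bx.
  wlog ab : a b a0 b0 ax bx / a <= b => [W|].
    have [|/ltW] := leP a b; first exact: W.
    by move=> ba; apply/esym/W.
  have Isub (y : R) : b < y -> I a y - I a b = I b y.
    move=> by_; rewrite /I.
    rewrite (@Rintegral_itvB _ f (BLeft a) (BRight y) b)//; last first.
      by rewrite bnd_simp ltW.
    rewrite Rintegral_itv_obnd_cbnd//.
    apply: (integrableS _ _ _ (intf b y)) => //.
    exact: subset_itv_oc_cc.
  by rewrite /G -(Isub x)// -(Isub 0)//; lra.
exists (fun x => G (Num.min x 0 - 1) x) => t.
have m0 : Num.min t 0 <= t /\ Num.min t 0 <= 0 by rewrite !ge_min !lexx orbT.
apply: near_eq_is_derive; last by apply: (dG (Num.min t 0 - 2)); lra.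
near=> x; have xt : t - 1 < x by near: x; apply: lt_nbhsr; lra.
have mx : Num.min x 0 <= x /\ Num.min x 0 <= 0 by rewrite !ge_min !lexx orbT.
by apply: GG; lra.
Unshelve. all: by end_near. Qed.

End OneVariable.

(** * The linear periodic problem *)
Section PeriodicFunctions.
Local Open Scope classical_set_scope.
Local Open Scope ring_scope.
Variable R : realType.
Implicit Types (f g F G U u p : R -> R).

Definition periodic1 f := forall t, f (t + 1) = f t.

Lemma periodic1_int f (n : int) t : periodic1 f -> f (t + n%:~R) = f t.
Proof.
move=> per_f; have per_nat (m : nat) s : f (s + m%:R) = f s.
  elim: m s => [|m IHm] s; first by rewrite addr0.
  by rewrite -natr1 addrA per_f IHm.
case: n => n; rewrite ?NegzE ?mulrNz -?pmulrn//.
by rewrite -[in RHS](subrK n.+1%:R t) per_nat.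
Qed.

Lemma antiderivative_const F c : antiderivative F (fun=> 0) -> F c = F 0.
Proof.
move=> dF; apply/eqP; rewrite -subr_eq0 -normr_le0.
have [c0|c0] := leP 0 c.
  have := antiderivative_bound dF c0 (K := 0).
  by rewrite mul0r; apply => t _; rewrite normr0.
rewrite distrC; have := antiderivative_bound dF (ltW c0) (K := 0).
by rewrite mul0r; apply => t _; rewrite normr0.
Qed.

Lemma antiderivative_shift F f c : antiderivative F f ->
  antiderivative (fun t => F (t + c)) (fun t => f (t + c)).
Proof.
move=> dF t; have dFtc : is_derive (shift c t) 1 F (f (t + c)) by exact: dF.
have := @is_derive1_comp _ F (shift c) t _ _ dFtc (is_derive_shift t 1 c).
by rewrite mulr1.
Qed.

Lemma antiderivativeB F f G g : antiderivative F f -> antiderivative G g ->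
  antiderivative (fun t => F t - G t) (fun t => f t - g t).
Proof. by move=> dF dG t; exact: is_deriveB. Qed.

Lemma antiderivativeD F f G g : antiderivative F f -> antiderivative G g ->
  antiderivative (fun t => F t + G t) (fun t => f t + g t).
Proof. by move=> dF dG t; exact: is_deriveD. Qed.

Lemma antiderivativeM F f G g : antiderivative F f -> antiderivative G g ->
  antiderivative (fun t => F t * G t) (fun t => f t * G t + F t * g t).
Proof.
move=> dF dG t; have := is_deriveM (dF t) (dG t).
by rewrite addrC [G t *: _]mulrC.
Qed.

Lemma antiderivative_cst (c : R) : antiderivative (fun=> c) (fun=> 0).
Proof. by move=> t; exact: is_derive_cst. Qed.

Lemma antiderivative_id : antiderivative (fun t : R => t) (fun=> 1).
Proof. by move=> t; exact: is_derive_id. Qed.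

Lemma antiderivative_sum n (F f : 'I_n -> R -> R) :
  (forall i, antiderivative (F i) (f i)) ->
  antiderivative (fun t => \sum_i F i t) (fun t => \sum_i f i t).
Proof.
move=> dF t; have := is_derive_sum (fun i => dF i t).
by rewrite fct_sumE.
Qed.

Lemma periodic1_antiderivative F f : antiderivative F f -> periodic1 f ->
  F 1 = F 0 -> periodic1 F.
Proof.
move=> dF per_f F10 t; apply/eqP; rewrite -subr_eq0.
have := antiderivativeB (antiderivative_shift 1 dF) dF.
rewrite (_ : (fun s => f (s + 1) - f s) = fun=> 0); last first.
  by apply/funext => s; rewrite per_f subrr.
by move=> /(antiderivative_const t) ->; rewrite add0r F10 subrr.
Qed.

Lemma periodic1_antiderivative_zero F f : antiderivative F f -> periodic1 F ->
  exists t, f t = 0.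
Proof.
move=> dF per_F; have [c _] := antiderivative_MVT dF ltr01.
have -> : F 1 = F 0 by rewrite -(per_F 0) add0r.
by rewrite subrr subr0 mulr1 => /esym ?; exists c.
Qed.

(** Sup-norm Poincare inequality: [u] vanishes somewhere by the mean value
    theorem applied to its periodic antiderivative, and every point lies, up
    to a period, within distance 1 to the right of that zero. *)
Lemma periodic1_bound U u g K : antiderivative U u -> antiderivative u g ->
  periodic1 U -> periodic1 u -> (forall t, `|g t| <= K) ->
  forall t, `|u t| <= K.
Proof.
move=> dU du per_U per_u gK t.
have [c uc0] := periodic1_antiderivative_zero dU per_U.
have K0 : 0 <= K by exact: le_trans (gK 0).
pose n := Num.floor (t - c); pose s := t - n%:~R.
have /andP[cs sc1] : c <= s < c + 1.
  have /andP[] := floor_itv (t - c).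
  by rewrite -/n /s intrD /=; lra.
rewrite -(subrK n%:~R t) periodic1_int// -/s -[u s]subr0 -uc0.
apply: le_trans (antiderivative_bound du cs (fun x _ => gK x)) _.
by rewrite -[leRHS]mulr1 ler_wpM2l//; lra.
Qed.

(** The solution [u] of [u'' = lambda - f].  The periodic antiderivative [U]
    of [u] encodes that [u] has mean zero, and the periodicity of [p = u']
    forces [lambda] to be the mean of [f].  Keeping [U] and [p] in the data
    lets every estimate be read off from derivatives. *)
Definition periodic_poisson f lambda U u p :=
  [/\ periodic1 U, periodic1 u & periodic1 p] /\
  [/\ antiderivative U u, antiderivative u p
    & antiderivative p (fun t => lambda - f t)].

(** [lambda] is a value of [f], since [p' = lambda - f] vanishes somewhere;
    then [periodic1_bound] is used twice, to go from [p'] to [p] and from [p]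
    to [u]. *)
Lemma periodic_poisson_bound f lambda U u p K :
  periodic_poisson f lambda U u p -> (forall t, `|f t| <= K) ->
  [/\ `|lambda| <= K, forall t, `|p t| <= 2 * K & forall t, `|u t| <= 2 * K].
Proof.
move=> [[per_U per_u per_p] [dU du dp]] fK.
have lK : `|lambda| <= K.
  have [c /eqP] := periodic1_antiderivative_zero dp per_p.
  by rewrite subr_eq0 => /eqP ->; exact: fK.
have pK : forall t, `|p t| <= 2 * K.
  apply: (periodic1_bound du dp) => // t.
  by rewrite mulr_natl mulr2n (le_trans (ler_normB _ _))// lerD.
by split => //; exact: (periodic1_bound dU du).
Qed.

Lemma periodic_poissonB f1 l1 U1 u1 p1 f2 l2 U2 u2 p2 :
  periodic_poisson f1 l1 U1 u1 p1 -> periodic_poisson f2 l2 U2 u2 p2 ->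
  periodic_poisson (fun t => f1 t - f2 t) (l1 - l2) (fun t => U1 t - U2 t)
    (fun t => u1 t - u2 t) (fun t => p1 t - p2 t).
Proof.
move=> [[pU1 pu1 pp1] [dU1 du1 dp1]] [[pU2 pu2 pp2] [dU2 du2 dp2]].
split; first by split=> t; rewrite ?pU1 ?pU2 ?pu1 ?pu2 ?pp1 ?pp2.
split; [exact: antiderivativeB..|].
have := antiderivativeB dp1 dp2; congr antiderivative.
by apply/funext => t; lra.
Qed.

(** The constant [c] is the mean of [f] over a period. *)
Lemma exists_periodic_antiderivative f : continuous f -> periodic1 f ->
  exists F c,
    [/\ periodic1 F, antiderivative F (fun t => f t - c) & continuous F].
Proof.
move=> cf per_f; have [F dF] := exists_antiderivative cf.
pose c := F 1 - F 0.
have dG : antiderivative (fun t => F t - c * t) (fun t => f t - c).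
  move=> t; apply: is_deriveB; first exact: dF.
  by have := is_deriveZ c (is_derive_id t (1 : R)); rewrite [c *: 1]mulr1.
exists (fun t => F t - c * t), c.
split; [|exact: dG|].
- apply: (periodic1_antiderivative dG) => [t|]; first by rewrite per_f.
  by rewrite /c; lra.
- exact: antiderivative_continuous dG.
Qed.

(** Three antiderivatives are taken.  Each of the last two removes the mean
    of the preceding one, and this also supplies the periodic antiderivative
    that normalises [u]. *)
Lemma exists_periodic_poisson f : continuous f -> periodic1 f ->
  exists lambda U u p, periodic_poisson f lambda U u p.
Proof.
move=> cf per_f.
have [P [lambda [per_P dP cP]]] := exists_periodic_antiderivative cf per_f.
have [W [c [per_W dW cW]]] := exists_periodic_antiderivative cP per_P.
have [S [e [per_S dS cS]]] := exists_periodic_antiderivative cW per_W.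
exists lambda, (fun t => - S t), (fun t => e - W t), (fun t => c - P t).
split; first by split=> t; rewrite ?per_S ?per_W ?per_P.
split=> t.
- by rewrite -[e - _]opprB; exact: is_deriveN.
- by rewrite -[c - _]opprB -[- (_ - _)]add0r; apply: is_deriveB.
- by rewrite -[lambda - _]opprB -[- (_ - _)]add0r; apply: is_deriveB.
Qed.

End PeriodicFunctions.

(** * Mean value formula in several variables *)
Section PartialDerivatives.
Local Open Scope classical_set_scope.
Local Open Scope ring_scope.
Variables (R : realType) (d : nat).
Implicit Types (f : 'rV[R]_d -> R) (x h v : 'rV[R]_d) (c e M : R).

Definition has_partials f := forall x i, derivable f x (delta_mx 0 i).

Lemma antiderivative_line f x v : (forall y, derivable f y v) ->
  antiderivative (fun s => f (x + s *: v)) (fun s => 'D_v f (x + s *: v)).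
Proof.
move=> df s; pose g (r : R) := f (x + r *: v).
have E : (fun h : R => h^-1 *: ((g \o shift s) (h *: (1 : R)) - g s)) =
    (fun h : R =>
      h^-1 *: ((f \o shift (x + s *: v)) (h *: v) - f (x + s *: v))).
  apply/funext => h /=; congr (_ *: (f _ - _)).
  by rewrite [h *: 1]mulr1 scalerDl addrCA.
by split; rewrite /derivable /derive -/g E; [exact: df|].
Qed.

Lemma MVT_line f x v c : (forall y, derivable f y v) ->
  exists2 s, `|s| <= `|c| & f (x + c *: v) - f x = 'D_v f (x + s *: v) * c.
Proof.
move=> df; have dg := antiderivative_line x df.
have [c0|c0|<-] := ltgtP 0 c.
- have [s /[!in_itv]/= /andP[s0 sc]] := antiderivative_MVT dg c0.
  rewrite scale0r addr0 subr0 => E; exists s => //.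
  by rewrite !gtr0_norm// ltW.
- have [s /[!in_itv]/= /andP[s0 sc]] := antiderivative_MVT dg c0.
  rewrite scale0r addr0 => E; exists s; first by rewrite !ltr0_norm// lerN2 ltW.
  by move: E; lra.
- by exists 0; rewrite // scale0r addr0 mulr0 subrr.
Qed.

(** Going from [x] to [x + h] one coordinate at a time, each step is an
    instance of the one-dimensional mean value theorem.  The intermediate
    points [z i] do not leave the box spanned by [x] and [x + h]; this
    locality is what the Taylor bound and the chain rule need. *)
Lemma partial_MVT f x h : has_partials f ->
  exists z : 'I_d -> 'rV[R]_d,
    (forall i j, `|(z i - x) 0 j| <= `|h 0 j|) /\
    f (x + h) - f x = \sum_i partial i f (z i) * h 0 i.
Proof.
move=> df.
pose y (k : nat) := x + \row_(i < d) (if (i < k)%N then h 0 i else 0).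
have yS (i : 'I_d) : y i.+1 = y i + h 0 i *: delta_mx 0 i.
  apply/rowP => j; rewrite !mxE eqxx /= ltnS leq_eqVlt -val_eqE /=.
  rewrite -[(j == i :> nat)]/(j == i). have [->|_] := eqVneq j i.
    by rewrite ltnn mulr1 addr0.
  by rewrite mulr0 addr0.
have /choice[z zP] (i : 'I_d) :
    exists z, (forall j, `|(z - x) 0 j| <= `|h 0 j|) /\
    f (y i.+1) - f (y i) = partial i f z * h 0 i.
  have [s sh E] := MVT_line (y i) (h 0 i) (fun y => df y i).
  exists (y i + s *: delta_mx 0 i); split; last by rewrite yS.
  move=> j; rewrite !mxE eqxx /=; have [->|_] := eqVneq j i.
    by rewrite ltnn mulr1 addr0 addrC addKr.
  by rewrite mulr0 addr0 addrC addKr; case: ifP; rewrite ?normr0.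
exists z; split => [i|]; first by case: (zP i).
have -> : x + h = y d by apply/rowP => j; rewrite !mxE ltn_ord.
have -> : x = y 0 by apply/rowP => j; rewrite !mxE ltn0 addr0.
rewrite -(telescope_sumr (f \o y) (leq0n d)) big_mkord.
by apply: eq_bigr => i _; case: (zP i).
Qed.

Lemma norm_sum_le (F : 'I_d -> R) c :
  (forall i, `|F i| <= c) -> `|\sum_i F i| <= d%:R * c.
Proof.
move=> Fc; apply: le_trans (ler_norm_sum _ _ _) _.
by rewrite mulr_natl -[X in _ *+ X]card_ord -sumr_const ler_sum.
Qed.

Lemma partial_lipschitz f M x h e : has_partials f ->
  (forall i y, `|partial i f y| <= M) -> (forall j, `|h 0 j| <= e) ->
  `|f (x + h) - f x| <= d%:R * (M * e).
Proof.
move=> df fM he; have [z [_ ->]] := partial_MVT x h df.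
by apply: norm_sum_le => i; rewrite normrM ler_pM.
Qed.

Lemma partial_taylor f M x h e : has_partials f ->
  (forall i, has_partials (partial i f)) ->
  (forall i j y, `|partial j (partial i f) y| <= M) ->
  (forall j, `|h 0 j| <= e) ->
  `|f (x + h) - f x - \sum_i partial i f x * h 0 i| <=
    d%:R * (d%:R * (M * e) * e).
Proof.
move=> df ddf fM he; have [z [zx ->]] := partial_MVT x h df.
rewrite -sumrB; apply: norm_sum_le => i.
rewrite -mulrBl normrM ler_pM// -[z i](subrK x) [z i - x + x]addrC.
have := @partial_lipschitz (partial i f) M x (z i - x) e (ddf i) (fM i).
by apply=> j; exact: le_trans (zx i j) (he j).
Qed.

Lemma ler_coord_norm x i : `|x 0 i| <= `|x|.
Proof.
by rewrite [leRHS]/Num.norm /= mx_normrE; exact: (le_bigmax _ _ (0, i)).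
Qed.

Lemma continuous_of_modulus f (K : R -> R) x :
  K r @[r --> (0 : R)] --> (0 : R) ->
  (forall y, `|f y - f x| <= K `|y - x|) -> {for x, continuous f}.
Proof.
move=> K0 fK A [e /= e0 eA].
have [r /= r0 rK] : nbhs (0 : R) [set r | K r < e].
  exact: (K0 _ (lt_nbhsl e0)).
apply/(@nbhs_ballP R); exists r => //= y; rewrite mx_norm_ball /ball_ /= => xy.
apply: eA; rewrite /ball_/= distrC (le_lt_trans (fK y))//.
by apply: rK; rewrite /ball_/= sub0r normrN normr_id distrC.
Qed.

Lemma cvg_rV (T : Type) (F : set_system T) (FF : Filter F)
    (Z : T -> 'rV[R]_d) x :
  (forall j, Z s 0 j @[s --> F] --> x 0 j) -> Z s @[s --> F] --> x.
Proof.
move=> Zx A [P xP PA].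
have : \forall s \near F, forall j, P 0 j (Z s 0 j).
  by apply: filter_forall => j; exact: (Zx j _ (xP 0 j)).
apply: filterS => s Ps; apply: PA => i j; rewrite (ord1 i); exact: Ps.
Qed.

Lemma continuous_rV (T : topologicalType) (Z : T -> 'rV[R]_d) :
  (forall j, continuous (fun s => Z s 0 j)) -> continuous Z.
Proof. by move=> cZ s; apply: cvg_rV => j; exact: cZ. Qed.

(** Chain rule along a curve.  By [partial_MVT] the difference quotient of
    [f (X t)] is a sum of products of partial derivatives at points tending
    to [X t] with difference quotients of the coordinates. *)
Lemma antiderivative_comp f (X : R -> 'rV[R]_d) (p : 'I_d -> R -> R) :
  has_partials f -> (forall i, continuous (partial i f)) ->
  (forall i, antiderivative (fun t => X t 0 i) (p i)) ->
  antiderivative (fun t => f (X t)) (fun t => \sum_i partial i f (X t) * p i t).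
Proof.
move=> df cdf dX t.
have /choice[z zP] s := partial_MVT (X t) (X (s + t) - X t) df.
have cX i : X (s + t) 0 i - X t 0 i @[s --> (0:R)^'] --> (0 : R).
  have /(_ t) cXt := antiderivative_continuous (dX i).
  rewrite -[0 in X in _ --> X](subrr (X t 0 i)).
  apply: cvgB; last exact: cvg_cst.
  have st : s + t @[s --> (0:R)^'] --> 0 + t.
    by apply: cvgD; [exact: cvg_within|exact: cvg_cst].
  rewrite add0r in st.
  exact: (cvg_comp (fun s => s + t) (fun t => X t 0 i) st cXt).
have cz i : z s i @[s --> (0:R)^'] --> X t.
  apply: cvg_rV => j; apply/subr_cvg0.
  have N0 : `|X (s + t) 0 j - X t 0 j| @[s --> (0:R)^'] --> (0 : R).
    by apply/norm_cvg0P; exact: cX.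
  have NN0 := cvgN N0; rewrite oppr0 in NN0.
  apply: (squeeze_cvgr _ (NN0 _) N0); near=> s.
  by rewrite -ler_norml; have [/(_ i j) + _] := zP s; rewrite !mxE.
pose quotient (y : R -> R) s := s^-1 *: ((y \o shift t) (s *: (1 : R)) - y t).
have lim : quotient (f \o X) s @[s --> (0 : R)^'] -->
    \sum_i partial i f (X t) * p i t.
  have -> : quotient (f \o X) =
      fun s => \sum_i partial i f (z s i) * quotient (fun t => X t 0 i) s.
    rewrite /quotient; apply/funext => s; have [_] := zP s.
    rewrite addrCA subrr addr0 /=.
    rewrite [s *: 1]mulr1 => ->; rewrite scaler_sumr; apply: eq_bigr => i _.
    by rewrite !mxE [in LHS]/GRing.scale/= [in RHS]/GRing.scale/= mulrCA.
  apply: cvg_big => [|i _]; first exact: add_continuous.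
  apply: cvgM.
    exact: (cvg_comp (fun s => z s i) (partial i f) (cz i) (cdf i (X t))).
  by have [dXi <-] := dX i t; exact: dXi.
by split; [apply/cvg_ex; eexists; exact: lim | exact: cvg_lim lim].
Unshelve. all: by end_near. Qed.

End PartialDerivatives.

(** * Sequences with geometric increments *)
Section GeometricLimits.
Local Open Scope classical_set_scope.
Local Open Scope ring_scope.
Variable R : realType.
Implicit Types (x y B : R) (a : nat -> R).

Lemma le_of_geometric x y B : (forall n, x <= y + B / 2 ^+ n) -> x <= y.
Proof.
move=> xy; have lim : y + B / 2 ^+ n @[n --> \oo] --> y + B * 0.
  apply: cvgD; first exact: cvg_cst.
  apply: cvgM; first exact: cvg_cst.
  rewrite (_ : (fun n => _) = (fun n : nat => (2^-1 : R) ^+ n)); last first.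
    by apply/funext => n; rewrite exprVn.
  by apply: cvg_expr; rewrite ger0_norm; lra.
rewrite mulr0 addr0 in lim.
by apply: (cvgr_to_ge lim); near=> n; exact: xy.
Unshelve. all: by end_near. Qed.

Lemma geometric_half B n : B / 2 ^+ n.+1 = B / 2 ^+ n / 2.
Proof. by rewrite exprSr invfM mulrA. Qed.

(** With [r n = 2 B / 2^n] the intervals [a n - r n, a n + r n] are nested, so
    the supremum of their left ends is a common point. *)
Lemma geometric_limit a B : (forall n, `|a n.+1 - a n| <= B / 2 ^+ n) ->
  exists l, forall n, `|a n - l| <= 2 * (B / 2 ^+ n).
Proof.
move=> aB; pose r n := 2 * (B / 2 ^+ n).
have rS n : r n.+1 = r n - B / 2 ^+ n.
  by rewrite /r geometric_half; lra.
have aS n : `|a n.+1 - a n| <= r n - r n.+1 by rewrite rS subKr.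
have incr m n : (m <= n)%N -> a m - r m <= a n - r n.
  move/subnK <-; elim: (n - m)%N => [|k IHk]; rewrite ?add0n// addSn.
  apply: le_trans IHk _; have := aS (k + m)%N.
  by rewrite ler_norml => /andP[]; lra.
have decr m n : (m <= n)%N -> a n + r n <= a m + r m.
  move/subnK <-; elim: (n - m)%N => [|k IHk]; rewrite ?add0n// addSn.
  apply: le_trans IHk; have := aS (k + m)%N.
  by rewrite ler_norml => /andP[]; lra.
have r0 n : 0 <= r n.
  have B0 : 0 <= B / 2 ^+ n by exact: le_trans (aB n).
  by rewrite /r mulr_ge0.
have cross m n : a m - r m <= a n + r n.
  apply: le_trans (incr m (maxn m n) (leq_maxl _ _)) _.
  apply: le_trans (decr n (maxn m n) (leq_maxr _ _)).
  by have := r0 (maxn m n); lra.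
exists (sup (range (fun m => a m - r m))) => n; rewrite ler_distlC.
apply/andP; split.
  apply: ub_le_sup; last by exists n.
  by exists (a 0%N + r 0%N) => _ [m _ <-]; exact: cross.
by apply: ge_sup; [exists (a 0%N - r 0%N), 0%N|move=> _ [m _ <-]; exact: cross].
Qed.

End GeometricLimits.

(** * Closed orbits of a weak periodic force *)
Section RotatingOrbit.
Local Open Scope classical_set_scope.
Local Open Scope ring_scope.
Variables (R : realType) (d : nat) (f : 'rV[R]_d -> R) (e M : R).
Hypothesis f_partials : has_partials f.
Hypothesis f_cont : continuous f.
Hypothesis df_partials : forall i, has_partials (partial i f).
Hypothesis df_cont : forall i, continuous (partial i f).
Hypothesis df_bound : forall i x, `|partial i f x| <= M.
Hypothesis ddf_bound : forall i j x, `|partial j (partial i f) x| <= M.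
Hypothesis f_periodic :
  forall x k : 'rV[R]_d, (forall j, k 0 j \is a Num.int) -> f (x + k) = f x.
Hypothesis e0 : 0 <= e.
Hypothesis e_small : e * (d%:R * M) <= 4^-1.

Implicit Types (a b h x k : 'rV[R]_d) (r s t : R).
Implicit Types (u p U : 'I_d -> R -> R) (lambda : 'I_d -> R).

Lemma partial_periodic i x k : (forall j, k 0 j \is a Num.int) ->
  partial i f (x + k) = partial i f x.
Proof.
move=> kint; rewrite /partial /derive.
suff -> : (fun c : R =>
      c^-1 *: ((f \o shift (x + k)) (c *: delta_mx 0 i) - f (x + k))) =
    (fun c => c^-1 *: ((f \o shift x) (c *: delta_mx 0 i) - f x)) by [].
by apply/funext => c /=; rewrite addrA !(f_periodic _ kint).
Qed.

(** The curve winding once in every coordinate direction per unit of time,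
    starting from the mean position [a] and deformed by [u]. *)
Definition path a u t : 'rV[R]_d := \row_j (a 0 j + t + u j t).

Lemma path_sub a u b v t :
  path b v t = path a u t + \row_j (b 0 j - a 0 j + (v j t - u j t)).
Proof. by apply/rowP => j; rewrite !mxE; lra. Qed.

Lemma path_periodic a u t : (forall j, periodic1 (u j)) ->
  path a u (t + 1) = path a u t + const_mx 1.
Proof. by move=> pu; apply/rowP => j; rewrite !mxE pu; lra. Qed.

Lemma path_continuous a u : (forall j, continuous (u j)) ->
  continuous (path a u).
Proof.
move=> cu; apply: continuous_rV => j.
rewrite (_ : (fun t => _) = fun t => a 0 j + t + u j t); last first.
  by apply/funext => t; rewrite mxE.
move=> t; apply: cvgD; last exact: cu.
by apply: cvgD; [exact: cvg_cst|exact: cvg_id].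
Qed.

Definition force a u j t := e * partial j f (path a u t).

Lemma force_bound a u j t : `|force a u j t| <= e * M.
Proof. by rewrite normrM ger0_norm// ler_wpM2l. Qed.

(** The smallness [e_small] of the force enters only here and in
    [action_expansion]; the factor 4 leaves a contraction ratio 1/2 after the
    factor 2 lost in [periodic_poisson_bound]. *)
Lemma force_lipschitz a u b v t r s (j : 'I_d) :
  (forall i, `|b 0 i - a 0 i| <= r) -> (forall i, `|v i t - u i t| <= s) ->
  `|force b v j t - force a u j t| <= (r + s) / 4.
Proof.
move=> ab uv; rewrite /force -mulrBr normrM ger0_norm// (path_sub a u).
set h := \row_i _.
have hrs i : `|h 0 i| <= r + s.
  by rewrite mxE (le_trans (ler_normD _ _))// lerD.
have rs0 : 0 <= r + s by exact: le_trans (hrs j).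
have lip := partial_lipschitz (path a u t) (@df_partials j) (ddf_bound j) hrs.
apply: (@le_trans _ _ (e * (d%:R * M) * (r + s))).
  by rewrite -!mulrA ler_wpM2l.
by rewrite mulrC ler_wpM2l.
Qed.

(** One step of Picard iteration: [v] solves the linear problem whose right
    hand side is the force along the curve deformed by [u]. *)
Definition forced_solution a u v lambda U p :=
  forall j, periodic_poisson (force a u j) (lambda j) (U j) (v j) (p j).

Lemma exists_forced_solution a u :
  (forall j, continuous (u j) /\ periodic1 (u j)) ->
  exists v lambda U p, forced_solution a u v lambda U p.
Proof.
move=> u_ok.
have sol j : exists s : R * (R -> R) * (R -> R) * (R -> R),
    periodic_poisson (force a u j) s.1.1.1 s.1.1.2 s.1.2 s.2.
  have cF : continuous (force a u j).
    move=> t; apply: cvgM; first exact: cvg_cst.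
    have /(_ t) cp : continuous (path a u).
      by apply: path_continuous => i; case: (u_ok i).
    exact: (cvg_comp (path a u) (partial j f) cp (@df_cont j (path a u t))).
  have pF : periodic1 (force a u j).
    move=> t; rewrite /force path_periodic ?partial_periodic// => i.
      by rewrite mxE.
    by case: (u_ok i).
  have [l [U [v [p s]]]] := exists_periodic_poisson cF pF.
  by exists (l, U, v, p).
have {sol}[s sP] := choice sol.
by exists (fun j => (s j).1.2), (fun j => (s j).1.1.1), (fun j => (s j).1.1.2),
  (fun j => (s j).2).
Qed.

Lemma forced_solution_bound a u v lambda U p j :
  forced_solution a u v lambda U p ->
  `|lambda j| <= e * M /\ forall t,
    `|v j t| <= 2 * (e * M) /\ `|p j t| <= 2 * (e * M).
Proof.
move=> /(_ j) sol.
have [lb pb vb] := periodic_poisson_bound sol (force_bound a u j).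
by split.
Qed.

Lemma forced_solution_contraction a u v lambda U p b u' v' lambda' U' p' r s :
  forced_solution a u v lambda U p -> forced_solution b u' v' lambda' U' p' ->
  (forall i, `|b 0 i - a 0 i| <= r) ->
  (forall i t, `|u' i t - u i t| <= s) ->
  forall i t, `|v' i t - v i t| <= (r + s) / 2 /\
    `|p' i t - p i t| <= (r + s) / 2.
Proof.
move=> sol sol' ab uu i t.
have := periodic_poisson_bound (periodic_poissonB (sol' i) (sol i)).
move=> /(_ _ (fun t => force_lipschitz i ab (uu^~ t)))[_ pb vb].
by have := pb t; have := vb t; lra.
Qed.

Definition orbit a u lambda U p := forced_solution a u u lambda U p.

(** The Picard iterates converge uniformly at a geometric rate.  Their common
    Lipschitz constant passes to the limit [u], which is therefore continuous
    and has a Picard image [v]; the contraction estimate shows [v = u], so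
    that no limit has to be taken in the differential equation. *)
Lemma exists_orbit a : exists u lambda U p, orbit a u lambda U p.
Proof.
pose S := {u : 'I_d -> R -> R | forall j, continuous (u j) /\ periodic1 (u j)}.
have step (s : S) : exists s' : S, exists lambda U p,
    forced_solution a (sval s) (sval s') lambda U p.
  have [v [lambda [U [p sol]]]] := exists_forced_solution a (svalP s).
  have v_ok j : continuous (v j) /\ periodic1 (v j).
    have [[_ pv _] [_ dv _]] := sol j.
    by split => //; exact: antiderivative_continuous dv.
  by exists (exist _ v v_ok), lambda, U, p.
have [next nextP] := choice step.
have zero_ok (j : 'I_d) : continuous ((fun=> fun=> 0) j : R -> R) /\
    periodic1 ((fun=> fun=> 0) j : R -> R).
  by split=> // t; exact: cvg_cst.
pose s n := sval (iter n next (exist _ (fun=> fun=> 0) zero_ok)).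
have sP n : exists lambda U p, forced_solution a (s n) (s n.+1) lambda U p.
  exact: nextP.
pose B := 2 * (e * M).
have rr i : `|a 0 i - a 0 i| <= 0 by rewrite subrr normr0.
have sS n j t : `|s n.+1 j t - s n j t| <= B / 2 ^+ n.
  elim: n j t => [|n IHn] j t.
    have [l [U [p sol]]] := sP 0%N.
    have [_ /(_ t)[+ _]] := forced_solution_bound j sol.
    by rewrite expr0 divr1 /s /= subr0.
  have [l [U [p sol]]] := sP n; have [l' [U' [p' sol']]] := sP n.+1.
  have [+ _] := forced_solution_contraction sol sol' rr IHn j t.
  by rewrite geometric_half add0r.
have lim (jt : 'I_d * R) : exists l, forall n,
    `|s n jt.1 jt.2 - l| <= 2 * (B / 2 ^+ n).
  by apply: geometric_limit => n; exact: sS.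
have {lim}[w wP] := choice lim.
pose u j t := w (j, t).
have uP n j t : `|s n j t - u j t| <= 2 * (B / 2 ^+ n) by exact: (wP (j, t)).
have u_per j : periodic1 (u j).
  move=> t; apply/eqP; rewrite -subr_eq0 -normr_le0.
  apply: (@le_of_geometric _ _ _ (4 * B)) => n.
  have ps : s n j (t + 1) = s n j t.
    by rewrite /s; case: (iter _ _ _) => /= v /(_ j)[_ ->].
  have := uP n j t; have := uP n j (t + 1); rewrite ps !ler_norml -mulrA.
  by move=> /andP[? ?] /andP[? ?]; apply/andP; split; lra.
have u_lip j t t' : t <= t' -> `|u j t' - u j t| <= B * (t' - t).
  move=> tt'; apply: (@le_of_geometric _ _ _ (4 * B)) => n.
  have [l [U [p sol]]] := sP n.
  have := uP n.+1 j t; have := uP n.+1 j t'; rewrite geometric_half.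
  have [_ [_ dv _]] := sol j.
  have := antiderivative_bound dv tt' (K := B).
  have pB t0 : t <= t0 <= t' -> `|p j t0| <= B.
    by move=> _; have [_ /(_ t0)[_]] := forced_solution_bound j sol.
  have B0 : 0 <= B / 2 ^+ n by exact: le_trans (sS n j t).
  move=> /(_ pB); rewrite !ler_norml -mulrA.
  by move=> /andP[? ?] /andP[? ?] /andP[? ?]; apply/andP; split; lra.
have u_cont j : continuous (u j).
  move=> t; apply/subr_cvg0.
  have lim : B * `|t' - t| @[t' --> t] --> B * `|t - t|.
    apply: cvgM; first exact: cvg_cst.
    apply: cvg_norm; apply: cvgB; [exact: cvg_id|exact: cvg_cst].
  rewrite subrr normr0 mulr0 in lim.
  have limN := cvgN lim; rewrite oppr0 in limN.
apply: (squeeze_cvgr _ (limN _) lim); near=> t'.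
  rewrite -ler_norml; have [tt'|/ltW tt'] := leP t t'.
    by rewrite [X in _ <= _ * X]ger0_norm ?subr_ge0// u_lip.
  by rewrite distrC [X in _ <= _ * X]distrC [X in _ <=
    _ * X]ger0_norm ?subr_ge0// u_lip.
have [v [lambda [U [p sol]]]] := exists_forced_solution a (fun j => conj (u_cont
  j) (u_per j)).
suff uv : v = u by exists u, lambda, U, p; move: sol; rewrite uv.
apply/funext => j; apply/funext => t; apply/eqP; rewrite -subr_eq0 -normr_le0.
apply: (@le_of_geometric _ _ _ (2 * B)) => n.
have [l' [U' [p' sol']]] := sP n.
have [+ _] := forced_solution_contraction sol sol' rr (uP n) j t.
have := uP n.+1 j t; rewrite geometric_half !ler_norml -mulrA.
by move=> /andP[? ?] /andP[? ?]; apply/andP; split; lra.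
Unshelve. all: by end_near. Qed.

(** If the deformations differ by at most [s], the contraction estimate
    improves [s] to [(r + s) / 2]; iterating this leaves [r].  The case [r = 0]
    says that the orbit over [a] is unique. *)
Lemma orbit_lipschitz a u lambda U p b v mu W q r :
  orbit a u lambda U p -> orbit b v mu W q ->
  (forall i, `|b 0 i - a 0 i| <= r) ->
  forall i t, `|v i t - u i t| <= r /\ `|q i t - p i t| <= r.
Proof.
move=> sol sol' ab.
pose B := 4 * (e * M).
have vu n i t : `|v i t - u i t| <= r + B / 2 ^+ n.
  elim: n i t => [|n IHn] i t.
    have r0 : 0 <= r by exact: le_trans (ab i).
    have [_ /(_ t)[ub _]] := forced_solution_bound i sol.
    have [_ /(_ t)[vb _]] := forced_solution_bound i sol'.
    rewrite expr0 divr1; apply: le_trans (ler_normB _ _) _.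
    by rewrite /B; lra.
  have [+ _] := forced_solution_contraction sol sol' ab IHn i t.
  by rewrite geometric_half; lra.
have vur i t : `|v i t - u i t| <= r.
  by apply: (@le_of_geometric _ _ _ B) => n; exact: vu.
move=> i t; split; first exact: vur.
by have [_] := forced_solution_contraction sol sol' ab vur i t; lra.
Qed.

(** Kinetic minus potential energy along the path; [1 + p] is the velocity. *)
Definition lagrangian a u p t :=
  \sum_j (1 + p j t) ^+ 2 / 2 - e * f (path a u t).

Lemma lagrangian_continuous a u lambda U p :
  orbit a u lambda U p -> continuous (lagrangian a u p).
Proof.
move=> sol t; apply: cvgB.
  apply: cvg_big => [|j _]; first exact: add_continuous.
  have [_ [_ _ dp]] := sol j; have /(_ t) cp := antiderivative_continuous dp.
  apply: cvgM; last exact: cvg_cst.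
  by apply: cvgM; apply: cvgD => //; exact: cvg_cst.
apply: cvgM; first exact: cvg_cst.
have /(_ t) cp : continuous (path a u).
  apply: path_continuous => j; have [_ [_ du _]] := sol j.
  exact: antiderivative_continuous du.
exact: (cvg_comp (path a u) f cp (@f_cont (path a u t))).
Qed.

(** First variation of the action.  Let [w] be the difference of the two
    paths.  After subtraction of the boundary term [x' w] and of the
    antiderivative of [lambda w], the difference of the Lagrangians is the
    square of the velocity difference minus the second order Taylor remainder
    of the potential, hence quadratic in the distance.  The boundary term does
    not contribute because [x'] and [w] are periodic, and [lambda w]
    contributes only [lambda (b - a)] because the deformations have mean
    zero. *)
Lemma action_expansion a u lambda U p A b v mu W q B r :
  orbit a u lambda U p -> orbit b v mu W q ->
  antiderivative A (lagrangian a u p) -> antiderivative B (lagrangian b v q) ->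
  (forall i, `|b 0 i - a 0 i| <= r) ->
  `|(B 1 - B 0) - (A 1 - A 0) + \sum_j lambda j * (b 0 j - a 0 j)|
    <= 2 * d%:R * r ^+ 2.
Proof.
move=> sol sol' dA dB ab.
pose w j t := b 0 j - a 0 j + (v j t - u j t).
have near_orbit := orbit_lipschitz sol sol' ab.
(* [E] is the difference of the actions up to time [t], corrected by the
   boundary term and by the antiderivative of [lambda w]; [g] is its
   derivative, in the form given by the product rule. *)
pose E t := B t - A t + \sum_j
  (lambda j * ((b 0 j - a 0 j) * t + (W j t - U j t)) - (1 + p j t) * w j t).
pose g t := lagrangian b v q t - lagrangian a u p t + \sum_j
  (lambda j * w j t -
    ((lambda j - force a u j t) * w j t + (1 + p j t) * (q j t - p j t))).
have dE : antiderivative E g.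
  apply: antiderivativeD; first exact: antiderivativeB.
  apply: antiderivative_sum => j.
  have [_ [dU du dp]] := sol j; have [_ [dW dv _]] := sol' j.
  apply: antiderivativeB.
    have := antiderivativeM (antiderivative_cst (lambda j))
      (antiderivativeD (antiderivativeM (antiderivative_cst (b 0 j - a 0 j))
         (@antiderivative_id R)) (antiderivativeB dW dU)).
    by congr antiderivative; apply/funext => t; rewrite /w; lra.
  have := antiderivativeM (antiderivativeD (antiderivative_cst 1) dp)
    (antiderivativeD (antiderivative_cst (b 0 j - a 0 j))
      (antiderivativeB dv du)).
  by congr antiderivative; apply/funext => t; rewrite /w; lra.
have -> : (B 1 - B 0) - (A 1 - A 0) + \sum_j lambda j * (b 0 j - a 0 j) =
    E 1 - E 0.
  rewrite /E [in RHS]opprD [RHS]addrACA -sumrB; congr (_ + _); first by lra.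
  apply: eq_bigr => j _.
  have [[pU pu pp] _] := sol j; have [[pW pv _] _] := sol' j.
  have at1 (F : R -> R) : (forall t, F (t + 1) = F t) -> F 1 = F 0.
    by move=> /(_ 0); rewrite add0r.
  by rewrite /w (at1 _ pu) (at1 _ pp) (at1 _ pv) (at1 _ pU) (at1 _ pW); lra.
apply: (@le_trans _ _ (2 * d%:R * r ^+ 2 * (1 - 0)));
  last by rewrite subr0 mulr1.
apply: (antiderivative_bound dE) => // t _.
have wb j : `|w j t| <= 2 * r.
  have [? _] := near_orbit j t; apply: le_trans (ler_normD _ _) _.
  by have := ab j; lra.
pose h : 'rV[R]_d := \row_j w j t.
have hb j : `|h 0 j| <= 2 * r by rewrite mxE.
have taylor := partial_taylor (path a u t) f_partials df_partials ddf_bound hb.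
have -> : g t = \sum_j (q j t - p j t) ^+ 2 / 2
    - e * (f (path a u t + h) - f (path a u t) -
      \sum_j partial j f (path a u t) * h 0 j).
  have key : \sum_j (1 + q j t) ^+ 2 / 2 - \sum_j (1 + p j t) ^+ 2 / 2 + \sum_j
      (lambda j * w j t -
        ((lambda j - force a u j t) * w j t + (1 + p j t) * (q j t - p j t)))
      = \sum_j (q j t - p j t) ^+ 2 / 2 +
        e * \sum_j partial j f (path a u t) * h 0 j.
    rewrite mulr_sumr -sumrB -!big_split; apply: eq_bigr => j _ /=.
    by rewrite mxE /force; lra.
  rewrite /g /lagrangian (path_sub a u b v) -/h.
  by move: key; lra.
apply: le_trans (ler_normB _ _) _.
have quadratic : `|\sum_j (q j t - p j t) ^+ 2 / 2| <= d%:R * r ^+ 2.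
  apply: norm_sum_le => j; rewrite normrM normrX [`|2^-1|]ger0_norm ?invr_ge0//.
  have [_ qp] := near_orbit j t.
  have : `|q j t - p j t| ^+ 2 <= r ^+ 2.
    by rewrite lerXn2r ?nnegrE// (le_trans _ qp).
  by have := exprn_ge0 2 (normr_ge0 (q j t - p j t)); lra.
apply: (@le_trans _ _ (d%:R * r ^+ 2 + d%:R * r ^+ 2)); last by lra.
apply: lerD => //; rewrite normrM ger0_norm//.
apply: le_trans (ler_wpM2l e0 taylor) _.
have : e * (d%:R * M) * (d%:R * r ^+ 2) <= 4^-1 * (d%:R * r ^+ 2).
  by apply: ler_wpM2r => //; rewrite mulr_ge0 ?ler0n ?sqr_ge0.
by lra.
Qed.

Lemma orbit_shift a k u lambda U p : (forall j, k 0 j \is a Num.int) ->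
  orbit a u lambda U p -> orbit (a + k) u lambda U p.
Proof.
move=> kint sol j; have := sol j; congr periodic_poisson.
apply/funext => t; rewrite /force -(partial_periodic j _ kint).
congr (_ * partial j f _).
by apply/rowP => i; rewrite !mxE; lra.
Qed.

Lemma lagrangian_shift a k u p : (forall j, k 0 j \is a Num.int) ->
  lagrangian (a + k) u p = lagrangian a u p.
Proof.
move=> kint; apply/funext => t.
rewrite /lagrangian -[in RHS](f_periodic _ kint).
by congr (_ - _ * f _); apply/rowP => i; rewrite !mxE; lra.
Qed.

(** Minimising the action [Phi] over the mean position [a] makes the
    multiplier [lambda] vanish: moving [a] along a coordinate where [lambda]
    is nonzero would decrease [Phi] to first order, while the error in
    [action_expansion] is quadratic. *)
Lemma exists_closed_orbit : exists a u p, forall j,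
  [/\ periodic1 (u j), antiderivative (u j) (p j)
    & antiderivative (p j) (fun t => - force a u j t)].
Proof.
have sol a : exists s : ('I_d -> R -> R) * ('I_d -> R -> R) * (R -> R),
    exists lambda U, orbit a s.1.1 lambda U s.1.2 /\
      antiderivative s.2 (lagrangian a s.1.1 s.1.2).
  have [u [lambda [U [p sol]]]] := exists_orbit a.
  have [A dA] := exists_antiderivative (lagrangian_continuous sol).
  by exists (u, p, A), lambda, U.
have {sol}[s sP] := choice sol.
pose Phi a := (s a).2 1 - (s a).2 0.
have expansion a : exists2 lambda : 'I_d -> R,
    (forall j, `|lambda j| <= e * M) &
    (exists U, orbit a (s a).1.1 lambda U (s a).1.2) /\
    forall b r, (forall i, `|b 0 i - a 0 i| <= r) ->
    `|Phi b - Phi a + \sum_j lambda j * (b 0 j - a 0 j)| <= 2 * d%:R * r ^+ 2.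
  have [lambda [U [sol dA]]] := sP a.
  exists lambda => [j|]; first by case: (forced_solution_bound j sol).
  split=> [|b r ab]; first by exists U.
  have [mu [W [sol' dB]]] := sP b.
  exact: action_expansion sol sol' dA dB ab.
have Phi_cont : continuous Phi.
  move=> a; have [lambda lambdaM [_ expn]] := expansion a.
  pose K r := d%:R * (e * M * r) + 2 * d%:R * r ^+ 2.
  have PhiK b : `|Phi b - Phi a| <= K `|b - a|.
    have ab i : `|b 0 i - a 0 i| <= `|b - a|.
      by have := ler_coord_norm (b - a) i; rewrite !mxE.
    have := expn b _ ab.
    have : `|\sum_j lambda j * (b 0 j - a 0 j)| <= d%:R * (e * M * `|b - a|).
      by apply: norm_sum_le => j; rewrite normrM ler_pM.
    rewrite /K !ler_norml => /andP[? ?] /andP[? ?]; apply/andP; split; lra.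
  apply: continuous_of_modulus PhiK.
  have lim : K r @[r --> (0 : R)] --> K 0.
    apply: cvgD.
      apply: cvgM; first exact: cvg_cst.
      by apply: cvgM; [exact: cvg_cst|exact: cvg_id].
    by apply: cvgM; [exact: cvg_cst|apply: cvgM; exact: cvg_id].
  by rewrite {2}/K !mulr0 expr0n mulr0 addr0 in lim.
have Phi_shift a k : (forall j, k 0 j \is a Num.int) -> Phi (a + k) = Phi a.
  move=> kint.
  have [lambda [U [sol dA]]] := sP a.
  have [mu [W [sol' dB]]] := sP (a + k).
  have rr i : `|(a + k) 0 i - (a + k) 0 i| <= 0 by rewrite subrr normr0.
  have same := orbit_lipschitz (orbit_shift kint sol) sol' rr.
  have su : (s (a + k)).1.1 = (s a).1.1.
    apply/funext => i; apply/funext => t; apply/eqP.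
    by rewrite -subr_eq0 -normr_le0; case: (same i t).
  have sp : (s (a + k)).1.2 = (s a).1.2.
    apply/funext => i; apply/funext => t; apply/eqP.
    by rewrite -subr_eq0 -normr_le0; case: (same i t).
  rewrite su sp lagrangian_shift// in dB.
  have dAB : antiderivative (fun t => (s (a + k)).2 t - (s a).2 t) (fun=> 0).
    have := antiderivativeB dB dA; congr antiderivative.
    by apply/funext => t; rewrite subrr.
  by have := antiderivative_const 1 dAB; rewrite /Phi; lra.
pose box := [set v : 'rV[R]_d | forall i, `[(0 : R), 1]%classic (v ord0 i)].
have [a _ amin] : exists2 a, a \in box & forall b, b \in box -> Phi a <= Phi b.
  apply: EVT_min_rV.
  - by exists 0 => i /=; rewrite mxE in_itv /= lexx ler01.
  - apply: (@rV_compact R d (fun=> `[(0 : R), 1]%classic)) => i.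
    exact: segment_compact.
  - by apply: continuous_subspaceT => v; exact: Phi_cont.
have {}amin b : Phi a <= Phi b.
  pose k : 'rV[R]_d := \row_i - (Num.floor (b 0 i))%:~R.
  have kint j : k 0 j \is a Num.int by rewrite mxE rpredN intr_int.
  rewrite -(Phi_shift b k kint); apply: amin; rewrite inE => i /=.
  have /andP[] := floor_itv (b 0 i); rewrite intrD /= => lb ub.
  by rewrite !mxE in_itv /=; apply/andP; split; lra.
have [lambda _ [[U sol] expn]] := expansion a.
have lambda0 j : lambda j = 0.
  pose c : R := 2 * d%:R + 1.
  have c0 : 0 < c by rewrite /c; have := ler0n R d; lra.
  (* The step maximising [lambda j * x - c * x ^+ 2]. *)
  pose x := lambda j / (2 * c).
  have := expn (a + x *: delta_mx 0 j) `|x|.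
  have h i : (a + x *: delta_mx 0 j) 0 i - a 0 i = x * (i == j)%:R.
    by rewrite !mxE eqxx /= addrC addKr.
  have hx i : `|(a + x *: delta_mx 0 j) 0 i - a 0 i| <= `|x|.
    by rewrite h normrM; case: eqP => _; rewrite ?normr1 ?normr0 ?mulr1 ?mulr0.
  move=> /(_ hx); under eq_bigr do rewrite h.
  rewrite (bigD1 j)//= big1 => [|i /negbTE ->]; last by rewrite !mulr0.
  rewrite eqxx mulr1 addr0 ler_norml real_normK ?num_real// => /andP[_].
  have := amin (a + x *: delta_mx 0 j).
  have -> : lambda j = 2 * c * x.
    by rewrite /x mulrC divfK// mulf_neq0 ?pnatr_eq0// gt_eqF.
  have := sqr_ge0 x; rewrite /c.
  move=> x2 Phi_min expn_x.
  have : x ^+ 2 <= 0 by have := mulr_ge0 (ler0n R d) x2; lra.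
  rewrite le_eqVlt ltNge x2 orbF sqrf_eq0 => /eqP ->.
  by rewrite mulr0.
exists a, (s a).1.1, (s a).1.2 => j; have [[_ pu _] [_ du dp]] := sol j.
split => //; move: dp; congr antiderivative; apply/funext => t.
by rewrite lambda0 add0r.
Qed.

End RotatingOrbit.

(** * Smoothness of the solutions *)
Section CnFunctions.
Local Open Scope classical_set_scope.
Local Open Scope ring_scope.
Variable R : realType.
Implicit Types (y z : R -> R).

Fixpoint Cn (n : nat) y : Prop :=
  if n is m.+1 then exists2 y', antiderivative y y' & Cn m y' else continuous y.

Lemma Cn_pred n y : Cn n.+1 y -> Cn n y.
Proof.
elim: n y => [|n IHn] y [y' dy] cy'; first exact: antiderivative_continuous dy.
by exists y' => //; exact: IHn.
Qed.

Lemma Cn_cst n (c : R) : Cn n (fun=> c).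
Proof.
elim: n c => [|n IHn] c /=; first by move=> t; exact: cvg_cst.
by exists (fun=> 0) => //; exact: antiderivative_cst.
Qed.

Lemma CnD n y z : Cn n y -> Cn n z -> Cn n (fun t => y t + z t).
Proof.
elim: n y z => [|n IHn] y z /=.
  by move=> cy cz t; apply: cvgD; [exact: cy|exact: cz].
move=> [y' dy cy] [z' dz cz]; exists (fun t => y' t + z' t); last exact: IHn.
exact: antiderivativeD.
Qed.

Lemma CnM n y z : Cn n y -> Cn n z -> Cn n (fun t => y t * z t).
Proof.
elim: n y z => [|n IHn] y z.
  by move=> cy cz t; apply: cvgM; [exact: cy|exact: cz].
move=> cy cz; have [cy0 cz0] := (Cn_pred cy, Cn_pred cz).
case: cy => y' dy cy; case: cz => z' dz cz.
exists (fun t => y' t * z t + y t * z' t); first exact: antiderivativeM.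
by apply: CnD; exact: IHn.
Qed.

Lemma Cn_sum n m (y : 'I_m -> R -> R) : (forall i, Cn n (y i)) ->
  Cn n (fun t => \sum_i y i t).
Proof.
elim: m y => [|m IHm] y cy.
  rewrite (_ : (fun t => _) = (fun=> 0)); first exact: Cn_cst.
  by apply/funext => t; rewrite big_ord0.
rewrite (_ : (fun t => _) = (fun t => y ord0 t + \sum_i y (lift ord0 i) t)).
  by apply: CnD; [exact: cy|exact: IHm].
by apply/funext => t; rewrite big_ord_recl.
Qed.

Lemma antiderivative_affine y z k s : antiderivative y z ->
  antiderivative (fun t => y (k * t + s)) (fun t => k * z (k * t + s)).
Proof.
move=> dy t; pose g (t : R) := k * t + s.
have dg : is_derive t (1 : R) g k.
  have := antiderivativeD (antiderivativeM (antiderivative_cst k)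
    (@antiderivative_id R)) (antiderivative_cst s) t.
  by rewrite mul0r add0r mulr1 addr0.
have dyg : is_derive (g t) (1 : R) y (z (g t)) by exact: dy.
by have := @is_derive1_comp _ y g t _ _ dyg dg; rewrite mulrC.
Qed.

Lemma Cn_affine n y k s : Cn n y -> Cn n (fun t => y (k * t + s)).
Proof.
elim: n y => [|n IHn] y /=.
  move=> cy t; have ct : k * t + s @[t --> t] --> k * t + s.
    apply: cvgD; last exact: cvg_cst.
    by apply: cvgM; [exact: cvg_cst|exact: cvg_id].
  exact: (cvg_comp (fun t => k * t + s) y ct (cy _)).
move=> [z dy cz]; exists (fun t => k * z (k * t + s)).
  exact: antiderivative_affine.
by apply: CnM; [exact: Cn_cst|exact: IHn].
Qed.

(** All iterated partial derivatives are treated together, because the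
    derivative of one along the curve involves the next ones. *)
Lemma Cn_comp d (f : 'rV[R]_d -> R) (X : R -> 'rV[R]_d) n : smooth f ->
  (forall j, Cn n (fun t => X t 0 j)) ->
  forall s, Cn n (fun t => iter_partial s f (X t)).
Proof.
move=> smf; elim: n => [|n IHn] cX s.
  move=> t; have [/(_ (X t)) cf _] := smf s.
  have /(_ t) cXt : continuous X by apply: continuous_rV => j; exact: cX.
  exact: (cvg_comp X (iter_partial s f) cXt cf).
have cX0 j := Cn_pred (cX j).
have /choice[p dp] j : exists p, antiderivative (fun t => X t 0 j) p /\ Cn n p.
  by have [p dp cp] := cX j; exists p.
exists (fun t => \sum_i iter_partial (i :: s) f (X t) * p i t).
  apply: antiderivative_comp.
  - by move=> x i; have [_] := smf s.
  - by move=> i; have [] := smf (i :: s).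
  - by move=> i; case: (dp i).
by apply: Cn_sum => i; apply: CnM; [exact: IHn|case: (dp i)].
Qed.

Definition infinitely_differentiable y := forall n, Cn n y.

Lemma infinitely_differentiable_derive y : infinitely_differentiable y ->
  antiderivative y ('D_1 y) /\ infinitely_differentiable ('D_1 y).
Proof.
move=> smy; have E z : antiderivative y z -> 'D_1 y = z.
  by move=> dy; apply/funext => t; case: (dy t).
by split=> [|n]; [have [z dy _] := smy 1%N|have [z dy cz] := smy n.+1];
  rewrite (E z).
Qed.

(** A function on the plane that depends on the first coordinate only. *)
Definition first_coord (y : R -> R) (t : 'rV[R]_2) : R := y (t 0 0).

Lemma partial_first_coord y z (i : 'I_2) : antiderivative y z ->
  (forall t, derivable (first_coord y) t (delta_mx 0 i)) /\
  partial i (first_coord y) = first_coord (if i == 0 then z else fun=> 0).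
Proof.
move=> dy.
have D t : is_derive t (delta_mx 0 i) (first_coord y)
    (first_coord (if i == 0 then z else fun=> 0) t).
  have E : (fun h : R => h^-1 *:
        ((first_coord y \o shift t) (h *: delta_mx 0 i) - first_coord y t)) =
      (fun h => h^-1 *: (y (h * (i == 0)%:R + t 0 0) - y (t 0 0))).
    by apply/funext => h; rewrite /first_coord /= !mxE eqxx eq_sym.
  rewrite /first_coord; have [i0|i0] := eqVneq i 0.
    have [dt Dt] := dy (t 0 0).
    split; rewrite /derivable /derive E i0 eqxx; first exact: dt.
    exact: Dt.
  have {}E : (fun h : R => h^-1 *:
        ((first_coord y \o shift t) (h *: delta_mx 0 i) - first_coord y t)) =
      (fun=> 0).
    rewrite E (negbTE i0); apply/funext => h.
    by rewrite mulr0 add0r subrr scaler0.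
  split; rewrite /derivable /derive E; first exact: is_cvg_cst.
  exact: lim_cst.
by split=> [t|]; [case: (D t)|apply/funext => t; case: (D t)].
Qed.

(** Functions of the first coordinate are stable under partial derivatives:
    these are 0 or again of this form. *)
Lemma smooth_first_coord y : infinitely_differentiable y ->
  smooth (first_coord y).
Proof.
move=> smy s; have [z smz ->] : exists2 z, infinitely_differentiable z &
    iter_partial s (first_coord y) = first_coord z.
  elim: s => [|i s [z smz E]]; first by exists y.
  have [dz smz'] := infinitely_differentiable_derive smz.
  have [_ P] := partial_first_coord i dz.
  exists (if i == 0 then 'D_1 z else fun=> 0); last by rewrite /= E P.
  by case: ifP => // _ n; exact: Cn_cst.
have [dz _] := infinitely_differentiable_derive smz.
split=> [t|x i]; last by have [] := partial_first_coord i dz.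
have cz : {for t 0 0, continuous z} := smz 0%N (t 0 0).
exact: (cvg_comp (fun t : 'rV[R]_2 => t 0 0) z
  (@coord_continuous _ _ _ 0 0 t) cz).
Qed.

End CnFunctions.

(** * Solutions on the torus *)
Section TorusSolutions.
Local Open Scope classical_set_scope.
Local Open Scope ring_scope.
Variable R : realType.

Lemma to_torusP n (x y : 'rV[R]_n) :
  (to_torus x = to_torus y) <-> (forall i, x 0 i - y 0 i \is a Num.int).
Proof.
split.
  by move=> /eqmodP /forallP.
by move=> xy; apply/eqmodP; apply/forallP.
Qed.

Lemma torus_function_periodic n (V : torus R n -> R) (x k : 'rV[R]_n) :
  (forall j, k 0 j \is a Num.int) ->
    (V \o @to_torus R n) (x + k) = (V \o @to_torus R n) x.
Proof.
move=> kint /=; congr V; apply/to_torusP => i.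
by rewrite !mxE addrAC subrr add0r.
Qed.

Lemma smooth_has_partials n (f : 'rV[R]_n -> R) s : smooth f ->
  has_partials (iter_partial s f).
Proof. by move=> smf x i; have [_] := smf s. Qed.

Lemma smooth_continuous n (f : 'rV[R]_n -> R) s : smooth f ->
  continuous (iter_partial s f).
Proof. by move=> smf; have [] := smf s. Qed.

(** The map between tori induced by [Q], computed on representatives; it is
    meaningful when [Q] is equivariant for the integer lattices. *)
Definition descend n (Q : 'rV[R]_2 -> 'rV[R]_n) : torus R 2 -> torus R n :=
  fun tau => to_torus (Q (repr tau)).

Lemma descend_to_torus n (Q : 'rV[R]_2 -> 'rV[R]_n) t :
  (forall (t t' : 'rV[R]_2) j, (forall i, t 0 i - t' 0 i \is a Num.int) ->
    Q t 0 j - Q t' 0 j \is a Num.int) ->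
  descend Q (to_torus t) = to_torus (Q t).
Proof.
move=> equivariant; apply/to_torusP => j; apply: equivariant.
by apply/to_torusP; rewrite /to_torus reprK.
Qed.

(** The speed [k] is chosen so large that the rescaled force [k^-2 grad V] is
    weak enough for [exists_closed_orbit].  Smoothness is a bootstrap: if
    the curve is [C^n], so is the force along it, and the curve, being a second
    antiderivative of the force, is [C^(n+2)]. *)
Lemma exists_rotating_curve d (V : torus R d -> R) :
  smooth_on_torus V -> finite_Ck_norm_on_torus 3 V ->
  exists (k : nat) (X : R -> 'rV[R]_d), [/\ (0 < k)%N,
    forall t, X (t + 1) = X t + const_mx 1,
    forall j, infinitely_differentiable (fun t => X t 0 j) &
    forall j, exists2 p, antiderivative (fun t => X t 0 j) p &
      antiderivative p
        (fun t => - k%:R ^- 2 * partial j (V \o @to_torus R d) (X t))].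
Proof.
rewrite /smooth_on_torus; set f := V \o _ => smf [M fM].
have fper (x k : 'rV[R]_d) : (forall j, k 0 j \is a Num.int) -> f (x + k) = f x.
  exact: torus_function_periodic.
have M0 : 0 <= M by exact: le_trans (fM [::] 0 isT).
pose k := (Num.truncn (4 * (d%:R * M))).+1.
have kbig : 4 * (d%:R * M) < k%:R by rewrite truncnS_gt.
have k0 : (0 : R) < k%:R by rewrite ltr0n.
have k1 : (1 : R) <= k%:R by rewrite ler1n.
pose e : R := k%:R ^- 2.
have e0 : 0 <= e by rewrite invr_ge0 exprn_ge0// ltW.
have e_small : e * (d%:R * M) <= 4^-1.
  rewrite mulrC ler_pdivrMr ?exprn_gt0// expr2.
  have : k%:R <= k%:R * k%:R :> R by rewrite ler_pMl.
  by lra.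
have [a [u [p uP]]] := exists_closed_orbit (@smooth_has_partials d f [::] smf)
  (@smooth_continuous d f [::] smf)
  (fun i => @smooth_has_partials d f [:: i] smf)
  (fun i => @smooth_continuous d f [:: i] smf) (fun i x => fM [:: i] x isT)
  (fun i j x => fM [:: j; i] x isT) fper e0 e_small.
pose X t := path a u t.
have dX j : antiderivative (fun t => X t 0 j) (fun t => 1 + p j t).
  have [_ du _] := uP j.
  have := antiderivativeD (antiderivativeD (antiderivative_cst (a 0 j))
    (@antiderivative_id R)) du.
  by congr antiderivative; apply/funext => t; rewrite ?mxE ?add0r.
have dp j : antiderivative (fun t => 1 + p j t)
    (fun t => - e * partial j f (X t)).
  have [_ _ dp] := uP j.
  have := antiderivativeD (antiderivative_cst 1) dp.
  by congr antiderivative; apply/funext => t; rewrite add0r mulNr.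
exists k, X; split => // [t|j|j].
- by apply: path_periodic => j; case: (uP j).
- move=> n; elim: n j => [|n IHn] j.
    exact: antiderivative_continuous (dX j).
  apply: Cn_pred; exists (fun t => 1 + p j t) => //.
  exists (fun t => - e * partial j f (X t)) => //.
  by apply: CnM; [exact: Cn_cst|exact: (Cn_comp smf IHn [:: j])].
- by exists (fun t => 1 + p j t).
Qed.

(** The solution is [t |-> X (k t_1 + s)].  The factor [k^2] produced by the
    two derivatives cancels the factor [k^-2] of the force.  The map descends
    to the torus because [X] advances by an integer vector whenever its argument
    advances by an integer, and [k] is an integer. *)
Lemma curve_laplace_solution d (V : torus R d -> R) (k : nat)
    (X : R -> 'rV[R]_d) s :
  (0 < k)%N ->
  (forall t, X (t + 1) = X t + const_mx 1) ->
  (forall j, infinitely_differentiable (fun t => X t 0 j)) ->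
  (forall j, exists2 p, antiderivative (fun t => X t 0 j) p &
    antiderivative p
      (fun t => - k%:R ^- 2 * partial j (V \o @to_torus R d) (X t))) ->
  exists q, laplace_solution V q /\ q (to_torus 0) = to_torus (X s).
Proof.
move=> k0 X1 smX dX.
have Xint t (m : int) j : X (t + m%:~R) 0 j = X t 0 j + m%:~R.
  have per : periodic1 (fun t => X t 0 j - t) by move=> r; rewrite X1 !mxE; lra.
  by have := periodic1_int m t per; lra.
pose y j (r : R) := X (k%:R * r + s) 0 j.
pose Q (t : 'rV[R]_2) : 'rV[R]_d := \row_j first_coord (y j) t.
have qE t : descend Q (to_torus t) = to_torus (Q t).
  apply: descend_to_torus => {}t t' j tt'; rewrite !mxE /first_coord /y.
  have /intrP[m tm] := tt' 0.
  have -> : k%:R * t 0 0 + s = k%:R * t' 0 0 + s + (k%:Z * m)%:~R.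
    by rewrite intrM pmulrn -tm; lra.
  by rewrite Xint addrC addKr intr_int.
have smy j : infinitely_differentiable (y j).
  by move=> n; exact: Cn_affine (smX j n).
have row_y j : (fun u => Q u 0 j) = first_coord (y j).
  by apply/funext => t; rewrite mxE.
exists (descend Q); split.
  exists Q; first split => [|j]; first exact: qE.
    by rewrite row_y; exact: smooth_first_coord.
  move=> t; apply/rowP => j; rewrite !mxE row_y.
  have [p dp ddp] := dX j.
  have dy := antiderivative_affine k%:R s dp.
  have ddy := antiderivativeM (antiderivative_cst k%:R)
    (antiderivative_affine k%:R s ddp).
  rewrite big_ord_recl big_ord1.
  have [_ ->] := partial_first_coord 0 dy.
  have [_ ->] := partial_first_coord (lift 0 0) dy.
  have [_ ->] := partial_first_coord 0 ddy.
  have [_ ->] := partial_first_coord (lift 0 0) (antiderivative_cst (0 : R)).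
  rewrite /first_coord /= mul0r add0r addr0 -[X (k%:R * t 0 0 + s)]/(X _).
  have -> : Q t = X (k%:R * t 0 0 + s) by apply/rowP => i; rewrite mxE.
  have kk : (k%:R : R) != 0 by rewrite pnatr_eq0 -lt0n.
  set G := partial j _ _.
  rewrite mulNr !mulrN opprK !mulrA -expr2 divff ?mul1r//.
  by rewrite expf_neq0.
rewrite qE; congr to_torus; apply/rowP => j.
by rewrite !mxE /first_coord /y mxE mulr0 add0r.
Qed.

(** As [t] runs over a period, the first coordinate of [X] increases by 1 and
    so takes the values [X 0 + i / N]; the translates of the solution by the
    times at which it does so differ at the origin of the torus. *)
Lemma exists_laplace_solutions d (V : torus R d -> R) (N : nat) : (0 < d)%N ->
  smooth_on_torus V -> finite_Ck_norm_on_torus 3 V ->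
  exists q : nat -> torus R 2 -> torus R d,
    (forall i, laplace_solution V (q i)) /\ {in `I_N &, injective q}.
Proof.
case: d V => // d V _ smV C3V.
have [k [X [k0 X1 smX dX]]] := exists_rotating_curve smV C3V.
have cX : continuous (fun t => X t 0 0) := smX 0 0%N.
have /choice[s sP] (i : nat) : exists s : R,
    (i < N)%N -> X s 0 0 = X 0 0 0 + i%:R / N%:R.
  have [iN|] := ltnP i N; last by exists 0.
  have N0 : (0 : R) < N%:R by rewrite ltr0n (leq_ltn_trans _ iN).
  have q0 : (0 : R) <= i%:R / N%:R by rewrite divr_ge0 ?ler0n.
  have q1 : i%:R / N%:R <= (1 : R) by rewrite ler_pdivrMr// mul1r ler_nat ltnW.
  have [||c _ Xc] :=
    @IVT R (fun t => X t 0 0) 0 1 (X 0 0 0 + i%:R / N%:R) ler01.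
  - by apply: continuous_subspaceT => t; exact: cX.
  - rewrite -[in X 1](add0r 1) X1 !mxE min_l ?max_r; lra.
  by exists c.
have [q qP] := choice (fun i => curve_laplace_solution (s i) k0 X1 smX dX).
exists q; split=> [i|i j]; first by case: (qP i).
rewrite !inE /= => iN jN qij.
have : to_torus (X (s i)) = to_torus (X (s j)).
  by case: (qP i) (qP j) => _ <- [_ <-]; rewrite qij.
move=> /to_torusP /(_ 0); rewrite !sP// opprD addrACA subrr add0r -mulrBl.
move=> /intrP[m mE].
have N0 : (0 : R) < N%:R by rewrite ltr0n (leq_ltn_trans _ iN).
have iNR : i%:R < N%:R :> R by rewrite ltr_nat.
have jNR : j%:R < N%:R :> R by rewrite ltr_nat.
have i0 := ler0n R i; have j0 := ler0n R j.
have ijE : i%:R - j%:R = m%:~R * N%:R :> R by rewrite -mE divfK// gt_eqF.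
have m0 : m = 0.
  have lb : -1 < m%:~R :> R by rewrite -(ltr_pM2r N0) -ijE; lra.
  have ub : m%:~R < 1 :> R by rewrite -(ltr_pM2r N0) -ijE; lra.
  move: lb ub; rewrite -[-1]/((-1)%:~R) -[1]/(1%:~R) !ltr_int.
  by case: m {mE ijE} => [[|?]|?].
by move: ijE; rewrite m0 mul0r => /eqP; rewrite subr_eq0 eqr_nat => /eqP.
Qed.

End TorusSolutions.

Local Open Scope card_scope.

Theorem corollary3p2 (R : realType) (d : nat) (hd : (1 <= d)%N)
    (V1 V2 : torus R d -> R)
    (smoothV1 : smooth_on_torus V1) (smoothV2 : smooth_on_torus V2)
    (C3V1 : finite_Ck_norm_on_torus 3 V1)
    (C3V2 : finite_Ck_norm_on_torus 3 V2) :
  `I_(2 * d + 1) #<= laplace_solutions V1 V2.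
Proof.
have [q1 [sol1 inj1]] := exists_laplace_solutions (2 * d + 1) hd smoothV1 C3V1.
have [q2 [sol2 _]] := exists_laplace_solutions 1 hd smoothV2 C3V2.
pose q i tau := (q1 i tau, q2 0%N tau).
have inj_q : {in `I_(2 * d + 1) &, injective q}.
  move=> i j iN jN qij; apply: inj1 => //; apply/funext => tau.
  by have [] := congr1 (fun g => g tau) qij.
rewrite -(card_le_eql (inj_card_eq inj_q)).
by apply: subset_card_le => _ [i _ <-]; split; [exact: sol1|exact: sol2].
Qed.
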